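(* There are constants $\mu>0$ and $d\in\mathbb{N}$ such that for all $\varepsilon>0$ and all sufficiently large $n$, there exists a tuple $\mathbf{B}=(B_1,\dots,B_d)$ of $n\times n$ complex unitary matrices such that $\mu(\mathbf{B})\ge\mu$ but $\lambda(\mathbf{B})<\varepsilon$.
   Context: $\mathrm{M}(n,\mathbb{C})$ is the space of $n\times n$ complex matrices, with inner product $\langle X,Y\rangle=\mathrm{Tr}(X^*Y)$. Dimension expansion: for a tuple $\mathbf{B}=(B_1,\dots,B_d)\in\mathrm{M}(n,\mathbb{C})^d$ and a subspace $V\le\mathbb{C}^n$, let $\mathbf{B}(V)$ be the linear span of $\bigcup_{i=1}^d B_i(V)$, where $B_i(V)=\{B_iv: v\in V\}$. The dimension expansion of $\mathbf{B}$ is $$\mu(\mathbf{B})=\min_{V\le\mathbb{C}^n,\ 1\le\dim V\le n/2}\frac{\dim(V+\mathbf{B}(V))-\dim V}{\dim V}.$$ Quantum expansion: a tuple $\mathbf{B}\in\mathrm{M}(n,\mathbb{C})^d$ is doubly stochastic if $\sum_i B_iB_i^*=\sum_i B_i^*B_i=dI_n$ (every tuple of unitary matrices is doubly stochastic). For such $\mathbf{B}$ let $\Phi_{\mathbf{B}}:\mathrm{M}(n,\mathbb{C})\to\mathrm{M}(n,\mathbb{C})$, $\Phi_{\mathbf{B}}(X)=\frac1d\sum_{i=1}^d B_iXB_i^*$, and let $\Lambda_{\mathbf{B}}=\mathcal{I}-\Phi_{\mathbf{B}}$, where $\mathcal{I}$ is the identity map on $\mathrm{M}(n,\mathbb{C})$.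 The quantum expansion $\lambda(\mathbf{B})$ is the second-smallest singular value (counted with multiplicity) of the linear operator $\Lambda_{\mathbf{B}}$ on $\mathrm{M}(n,\mathbb{C})$. *)

(* Defs.v *)
From HB Require Import structures.
From mathcomp Require Import all_boot all_order all_algebra.
From mathcomp Require Import complex.
From mathcomp Require Import boolp classical_sets cardinality reals.

Set Implicit Arguments.
Unset Strict Implicit.
Unset Printing Implicit Defensive.

Import Order.TTheory GRing.Theory Num.Theory.

Local Open Scope ring_scope.
Local Open Scope complex_scope.
Local Open Scope sesquilinear_scope.
Local Open Scope classical_set_scope.

Definition tuple_image (R : realType) (n d : nat) (B : 'I_d -> 'M[R[i]]_n)
    (V : {vspace 'cV[R[i]]_n}) : {vspace 'cV[R[i]]_n} :=
  (\sum_(i < d) (linfun (mulmx (B i)) @: V))%VS.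

(* [tuple_image B V] is the span of the union of the [B i V]: the least
   subspace containing every [B i *m v] with [v \in V]. *)
Lemma tuple_image_subP (R : realType) (n d : nat) (B : 'I_d -> 'M[R[i]]_n)
    (V W : {vspace 'cV[R[i]]_n}) :
  (tuple_image B V <= W)%VS <-> (forall i v, v \in V -> B i *m v \in W).
Proof.
split=> [/subv_sumP sBW i v vV | sBW].
  have /subvP := sBW i isT; apply; have := memv_img (linfun (mulmx (B i))) vV.
  by rewrite lfunE.
apply/subv_sumP => i _; apply/subvP => w /memv_imgP[v vV ->].
by rewrite lfunE; apply: sBW.
Qed.

Definition expansion_ratio (R : realType) (n d : nat) (B : 'I_d -> 'M[R[i]]_n)
    (V : {vspace 'cV[R[i]]_n}) : R :=
  ((\dim (V + tuple_image B V))%:R - (\dim V)%:R) / (\dim V)%:R.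

Definition expansion_ratios (R : realType) (n d : nat)
    (B : 'I_d -> 'M[R[i]]_n) : set R :=
  [set expansion_ratio B V | V in
     [set V : {vspace 'cV[R[i]]_n} |
        (1 <= \dim V)%N /\ (\dim V)%:R <= n%:R / 2 :> R]].

(* The minimum over subspaces is taken as an infimum in [R]; it is attained as
   soon as some subspace qualifies ([dim_expansion_attained], [n >= 2]). *)
Definition dim_expansion (R : realType) (n d : nat)
    (B : 'I_d -> 'M[R[i]]_n) : R :=
  inf (expansion_ratios B).

Lemma dim_expansion_attained (R : realType) (n d : nat)
    (B : 'I_d -> 'M[R[i]]_n) : (2 <= n)%N ->
  expansion_ratios B (dim_expansion B) /\
  (forall x, expansion_ratios B x -> dim_expansion B <= x).
Proof.
move=> n2; set S := expansion_ratios B.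
pose f (p : 'I_n.+1 * 'I_n.+1) : R := (p.1%:R - p.2%:R) / p.2%:R.
have dim_lt (V : {vspace 'cV[R[i]]_n}) : (\dim V < n.+1)%N.
  by rewrite ltnS (leq_trans (dimvS (subvf V))) // dimvf /dim /= muln1.
have Ssub x : S x -> x \in codom f.
  move=> [V _ <-]; apply/codomP.
  by exists (Ordinal (dim_lt (V + tuple_image B V)%VS), Ordinal (dim_lt V)).
have [x0 Sx0] : exists x, S x.
  pose v : 'cV[R[i]]_n := const_mx 1.
  exists (expansion_ratio B <[v]>%VS), <[v]>%VS => //=.
  have v0 : v != 0.
    apply/eqP => /colP /(_ (Ordinal (ltnW n2))); rewrite !mxE => /eqP.
    by rewrite oner_eq0.
  by rewrite dim_vline v0 /= ler_pdivlMr ?ltr0n // mul1r ler_nat.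
have [p0 fp0] : exists p, f p = x0.
  by have /codomP[p ->] := Ssub _ Sx0; exists p.
have Pp0 : `[< S (f p0) >] by apply/asboolP; rewrite fp0.
case: (@arg_minP _ _ _ p0 (fun p => `[< S (f p) >]) f Pp0) => p /asboolP Sp pmin.
have lbS : lbound S (f p).
  by move=> x Sx; have /codomP[q xq] := Ssub _ Sx; rewrite xq pmin // -xq;
    apply/asboolP.
have infE : dim_expansion B = f p.
  apply/le_anti/andP; split.
    by apply: ge_inf => //; exists (f p).
  by apply: lb_le_inf => //; exists (f p).
by rewrite infE.
Qed.

Definition quantum_channel (R : realType) (n d : nat) (B : 'I_d -> 'M[R[i]]_n)
    (X : 'M[R[i]]_n) : 'M[R[i]]_n :=
  d%:R^-1 *: \sum_(i < d) (B i *m X *m (B i)^t*).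

Definition quantum_laplacian (R : realType) (n d : nat)
    (B : 'I_d -> 'M[R[i]]_n) (X : 'M[R[i]]_n) : 'M[R[i]]_n :=
  X - quantum_channel B X.

Lemma quantum_laplacian_is_linear (R : realType) (n d : nat)
    (B : 'I_d -> 'M[R[i]]_n) : linear (quantum_laplacian B).
Proof.
move=> a X Y; rewrite /quantum_laplacian /quantum_channel.
rewrite (eq_bigr (fun i => a *: (B i *m X *m (B i)^t*) +
    B i *m Y *m (B i)^t*)); last first.
  by move=> i _; rewrite mulmxDr mulmxDl -scalemxAr -scalemxAl.
by rewrite big_split /= -scaler_sumr scalerDr scalerA mulrC -scalerA opprD
  addrACA scalerBr.
Qed.

HB.instance Definition _ (R : realType) (n d : nat) (B : 'I_d -> 'M[R[i]]_n) :=
  GRing.isLinear.Build R[i] 'M[R[i]]_n 'M[R[i]]_n _ (quantum_laplacian B)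
    (quantum_laplacian_is_linear B).

(* The singular values, with multiplicity and in increasing order, of the
   endomorphism [u |-> u *m A] of the space of row vectors with its standard
   Hermitian inner product. Its adjoint is [u |-> u *m A^t*], so they are the
   square roots of the eigenvalues of [A *m A^t*], which are real and
   nonnegative (see [singular_values_spec]). *)
Definition singular_values (R : realType) (m : nat) (A : 'M[R[i]]_m) : seq R :=
  sort <=%R
    [seq Num.sqrt (complex.Re (spectral_diag (A *m A^t*) 0 j)) | j : 'I_m].

Lemma gram_spectral_diag_ge0 (R : realType) (m : nat) (A : 'M[R[i]]_m)
    (j : 'I_m) : 0 <= spectral_diag (A *m A^t*) 0 j.
Proof.
set M := A *m A^t*; set P := spectralmx M.
have Mn : M \is normalmx by apply/normalmxP; rewrite /M trmx_mul map_mxM trmxCK.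
have /orthomx_spectralP := Mn; rewrite -/P => ME.
have DE : diag_mx (spectral_diag M) = (P *m A) *m (P *m A)^t*.
  rewrite trmx_mul map_mxM mulmxA -(mulmxA P) -/M.
  rewrite -invmx_unitary ?spectral_unitarymx // {2}ME.
  by rewrite !mulmxA mulmxK ?spectral_unit // mulmxV ?spectral_unit // mul1mx.
have := congr1 (fun X : 'M_m => X j j) DE; rewrite !mxE eqxx mulr1n => ->.
by apply: sumr_ge0 => k _; rewrite !mxE mul_conjC_ge0.
Qed.

Lemma singular_values_spec (R : realType) (m : nat) (A : 'M[R[i]]_m) :
  [/\ sorted <=%R (singular_values A),
      all (fun s => 0 <= s) (singular_values A) &
      char_poly (A *m A^t*) =
        \prod_(s <- singular_values A) ('X - ((s ^+ 2)%:C)%:P)].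
Proof.
split.
- exact: sort_le_sorted.
- by rewrite all_sort; apply/allP => _ /mapP[j _ ->]; exact: sqrtr_ge0.
have psort : perm_eq (singular_values A)
  [seq Num.sqrt (complex.Re (spectral_diag (A *m A^t*) 0 j)) | j : 'I_m].
  by rewrite perm_sort.
rewrite (perm_big _ psort) /= big_map big_enum /=.
have Mn : A *m A^t* \is normalmx.
  by apply/normalmxP; rewrite trmx_mul map_mxM trmxCK.
have /orthomx_spectralP ME := Mn.
rewrite [in LHS]ME; set D := spectral_diag _; set P := spectralmx _.
have -> : char_poly (invmx P *m diag_mx D *m P) = char_poly (diag_mx D).
  have PU : P \in unitmx := spectral_unit _.
  rewrite /char_poly /char_poly_mx !map_mxM /=.
  set Q := map_mx polyC P; set Q' := map_mx polyC (invmx P).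
  have Q'Q : Q' *m Q = 1%:M by rewrite -map_mxM mulVmx // map_mx1.
  have -> : 'X%:M - Q' *m map_mx polyC (diag_mx D) *m Q =
      Q' *m ('X%:M - map_mx polyC (diag_mx D)) *m Q.
    by rewrite mulmxBr mulmxBl mul_mx_scalar -scalemxAl Q'Q scalemx1.
  by rewrite !det_mulmx mulrAC -det_mulmx Q'Q det1 mul1r.
rewrite char_poly_trig ?diag_mx_is_trig //.
apply: eq_bigr => j _; rewrite !mxE eqxx mulr1n sqr_sqrtr.
  have := gram_spectral_diag_ge0 A j; rewrite -/D.
  by case: (D 0 j) => a b; rewrite lecE /= => /andP[/eqP-> _].
have := gram_spectral_diag_ge0 A j; rewrite -/D.
by case: (D 0 j) => a b; rewrite lecE /= => /andP[].
Qed.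

(* [mxvec] is an isometry from matrices, with the inner product
   [\tr (X^t* *m Y)], to row vectors; hence the singular values of an operator
   on matrices are those of [lin_mx], its matrix in the coordinates [mxvec]
   (acting on rows: [mxvec X *m lin_mx f = mxvec (f X)]). *)
Lemma mxtrace_mxvec (R : realType) (n : nat) (X Y : 'M[R[i]]_n) :
  \tr (X^t* *m Y) = (mxvec Y *m (mxvec X)^t*) 0 0.
Proof.
rewrite mxE (reindex _ (curry_mxvec_bij n n)) /=.
rewrite (eq_bigr (fun p : 'I_n * 'I_n => (Y p.1 p.2) * (X p.1 p.2)^*)%R);
  last by case=> i j _; rewrite /= !mxE !mxvecE.
rewrite -(pair_bigA _ (fun i j => Y i j * (X i j)^*)) /= exchange_big.
apply: eq_bigr => j _; rewrite mxE; apply: eq_bigr => i _.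
by rewrite !mxE mulrC.
Qed.

Definition operator_singular_values (R : realType) (n : nat)
    (f : {linear 'M[R[i]]_n -> 'M[R[i]]_n}) : seq R :=
  singular_values (lin_mx f).

Definition quantum_expansion (R : realType) (n d : nat)
    (B : 'I_d -> 'M[R[i]]_n) : R :=
  nth 0 (operator_singular_values (quantum_laplacian B)) 1.

(* Main.v *)
Require Import Defs.
From mathcomp Require Import all_boot all_order all_fingroup all_algebra.
From mathcomp Require Import complex.
From mathcomp Require Import reals.
From mathcomp Require Import zify ring.

(* Dimension expansion only sees exact linear algebra, so it survives moving the
   matrices arbitrarily close to the identity, where the quantum expansion tends
   to 0. If (H_i) is a Hermitian dimension expander, so is the tuple of Cayley
   transforms U_i = (1 + itH_i)(1 - itH_i)^-1 for every real t <> 0, with a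
   constant independent of t: writing U_i = 2 S_i^-1 - 1 with S_i = 1 - itH_i,
   if V + U(V) is barely larger than V, then V meets all the S_i^-1 V in a
   subspace V' almost as large as V, and H_i V' lies in V + S_i^-1 V, which is
   contained in V + U(V). As t -> 0 the Laplacian of (U_i) tends to 0 entrywise.

   Hermitian parts reduce the existence of (H_i) to that of any constant-degree
   dimension expander over C. To get one, view vectors as polynomials of degree
   less than n, send V to the sum of the X^(ni) V for i < 4, of dimension 4 dim V,
   and map this space W back to C^n by evaluation at the n points
   2^(jn), ..., 2^(jn+n-1), for j < 100. The kernels of these maps form a subspace
   design in the sense of Guruswami and Kopparty: the multiplicative Wronskian
   det f_i(2^l X) of a basis (f_i) of W is a nonzero polynomial of small degree,
   and each dimension of W killed by an evaluation map gives it n - dim W + 1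
   zeros counted with multiplicity. Hence some map kills at most a fifth of W. *)

Set Implicit Arguments.
Unset Strict Implicit.
Unset Printing Implicit Defensive.
Import Order.TTheory GRing.Theory Num.Theory.

Local Open Scope ring_scope.
Local Open Scope complex_scope.
Local Open Scope sesquilinear_scope.

(** * Zeros of polynomials, multiplicative Wronskians and subspace designs *)

Lemma sum_mup_leq (F : fieldType) (q : {poly F}) (s : seq F) :
  q != 0 -> uniq s -> (\sum_(x <- s) mup x q <= (size q).-1)%N.
Proof.
elim: s q => [|x s IHs] q q0 /=; first by rewrite big_nil.
case/andP=> xs us; rewrite big_cons.
have /dvdpP[p qE] : ('X - x%:P) ^+ mup x q %| q by rewrite -mup_geq.
have p0 : p != 0 by apply: contraNneq q0 => p0; rewrite qE p0 mul0r.
have sq : (size q).-1 = (mup x q + (size p).-1)%N.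
  rewrite {1}qE size_mul ?expf_neq0 ?polyXsubC_eq0 // size_exp_XsubC.
  by rewrite addnS /= addnC -[in LHS](prednK (n := size p)) ?size_poly_gt0 // addnS.
rewrite sq leq_add2l; apply: leq_trans (IHs p p0 us).
rewrite !big_seq; apply: leq_sum => y ys.
rewrite {1}qE mupMl // rootE horner_exp !hornerE expf_eq0 subr_eq0 negb_and.
by apply/orP; right; apply: contraNneq xs => <-.
Qed.

(* Change basis so that the rows beyond the rank of [M(x)] vanish at [x], and
   pull a factor ['X - x] out of each of them. *)
Lemma corank_leq_mup_det (F : fieldType) (s : nat) (M : 'M[{poly F}]_s) (x : F) :
  \det M != 0 ->
  (s - \rank (map_mx (horner^~ x) M) <= mup x (\det M))%N.
Proof.
move=> dM0; set M0 := map_mx _ M; set r := \rank M0.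
have evE : M0 = map_mx (horner_eval x) M by [].
pose L := invmx (col_ebase M0); pose N := map_mx polyC L *m M.
have LM0 : L *m M0 = pid_mx r *m row_ebase M0.
  by rewrite -{1}[M0]mulmx_ebase /L mulmxA mulKmx // col_ebase_unit.
have N0 : map_mx (horner_eval x) N = L *m M0.
  rewrite map_mxM -map_mx_comp evE; congr (_ *m _).
  by apply/matrixP => i j; rewrite !mxE /= /horner_eval hornerC.
have Nroot (i : 'I_s) j : (r <= i)%N -> N i j = (N i j %/ ('X - x%:P)) * ('X - x%:P).
  move=> ri; rewrite divpK // dvdp_XsubCl rootE; apply/eqP.
  have := congr1 (fun A : 'M_s => A i j) N0; rewrite LM0 mxE /horner_eval => ->.
  rewrite mxE big1 // => k _; rewrite !mxE ltnNge ri andbF mul0r //.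
pose D : 'rV[{poly F}]_s := \row_i (if (r <= i)%N then 'X - x%:P else 1).
pose N' := \matrix_(i, j) (if (r <= i)%N then N i j %/ ('X - x%:P) else N i j).
have NE : N = diag_mx D *m N'.
  apply/matrixP => i j; rewrite mul_diag_mx [RHS]mxE [D 0 i]mxE [N' i j]mxE.
  by case: ifP => [ri|_]; rewrite ?mul1r // [LHS]Nroot // mulrC.
have L1 : \det L != 0 by rewrite -unitfE -unitmxE unitmx_inv col_ebase_unit.
have dN : \det N = (\det L)%:P * \det M by rewrite det_mulmx det_map_mx.
have dD : \det (diag_mx D) = ('X - x%:P) ^+ (s - r).
  rewrite det_diag (eq_bigr (fun i : 'I_s => if (r <= i)%N then 'X - x%:P else 1));
    last by move=> i _; rewrite mxE.
  rewrite -big_mkcond -(big_mkord (fun i => (r <= i)%N) (fun=> 'X - x%:P)).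
  by rewrite -(big_nat_widenl _ _ _ xpredT) // prodr_const_nat.
rewrite mup_geq // -dD -(dvdpZr _ _ L1) -mul_polyC -dN NE det_mulmx.
exact: dvdp_mulr.
Qed.

(* Among all changes of basis take one whose lowest positions have the largest
   sum: if two of them agreed, a row operation would increase the sum. *)
Lemma lowest_echelon (F : fieldType) (s m : nat) (A : 'M[F]_(s, m)) :
  row_free A -> exists (P : 'M[F]_s) (v : 'I_s -> 'I_m),
    [/\ P \in unitmx, injective v,
        forall i, (P *m A) i (v i) != 0 &
        forall i (k : 'I_m), (k < v i)%N -> (P *m A) i k = 0].
Proof.
move=> Afree.
have low (Q : 'M[F]_(s, m)) : row_free Q -> exists v : {ffun 'I_s -> 'I_m},
    (forall i, Q i (v i) != 0) /\ (forall i (k : 'I_m), (k < v i)%N -> Q i k = 0).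
  move=> Qfree.
  have ex i : exists k, Q i k != 0.
    apply/existsP; apply: contraT; rewrite negb_exists => /forallP Qi0.
    have : delta_mx 0 i *m Q = 0 :> 'rV_m.
      rewrite -rowE; apply/rowP => k; rewrite !mxE; apply/eqP.
      by have := Qi0 k; rewrite negbK.
    move/(congr1 (mulmx^~ (pinvmx Q))); rewrite mul0mx -mulmxA mulmxVp // mulmx1.
    by move/rowP/(_ i)/eqP; rewrite !mxE !eqxx oner_eq0.
  have w i : {k : 'I_m | Q i k != 0 /\ forall l : 'I_m, (l < k)%N -> Q i l = 0}.
    have [k0 k0P] := sigW (ex i).
    case: (@arg_minnP _ k0 (fun k => Q i k != 0) (@nat_of_ord m) k0P) => k kP kmin.
    exists k; split=> // l lk; apply/eqP; apply: contraTT lk; rewrite -leqNgt.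
    exact: kmin.
  exists [ffun i => sval (w i)]; split=> i; rewrite ffunE; case: (w i) => k [] //=.
pose good (v : {ffun 'I_s -> 'I_m}) := exists P : 'M[F]_s,
  [/\ P \in unitmx, forall i, (P *m A) i (v i) != 0 &
        forall i (k : 'I_m), (k < v i)%N -> (P *m A) i k = 0].
pose wt (v : {ffun 'I_s -> 'I_m}) := (\sum_i v i)%N.
have step v : good v -> injective v \/ exists2 v', good v' & (wt v < wt v')%N.
  case=> P [Pu Pv0 Plow].
  have [/injectiveP vi|] := boolP (injectiveb v); first by left.
  case/injectivePn=> i [j ij vij]; right.
  pose c := (P *m A) j (v j) / (P *m A) i (v i).
  (* [T] subtracts [c] times row [i] from row [j], cancelling the entry at their common lowest
     position. *)
  pose T : 'M[F]_s := 1%:M - c *: delta_mx j i.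
  have Tu : T \in unitmx.
    have : T *m (1%:M + c *: delta_mx j i) = 1%:M.
      rewrite mulmxDr mulmx1 mulmxBl mul1mx -scalemxAl -scalemxAr mul_delta_mx_cond.
      by rewrite (negbTE ij) mulr0n !scaler0 subr0 subrK.
    by case/mulmx1_unit.
  have TPA k l : (T *m P *m A) k l = (P *m A) k l - (c * (k == j)%:R) * (P *m A) i l.
    rewrite -mulmxA /T mulmxBl mul1mx -scalemxAl !mxE; congr (_ - _).
    rewrite -mulrA; congr (_ * _).
    rewrite (bigD1 i) //= big1 => [|t ti]; last by rewrite !mxE (negbTE ti) andbF mul0r.
    by rewrite !mxE eqxx andbT addr0; congr (_ * _); rewrite !mxE.
  have TPu : T *m P \in unitmx by rewrite unitmx_mul Tu.
  have [|v' [v'0 v'low]] := low (T *m P *m A).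
    by rewrite /row_free mxrankMfree // mxrank_unit.
  have lev k : (v k <= v' k)%N.
    rewrite leqNgt; apply/negP => v'k; have := v'0 k; rewrite TPA (Plow k) // sub0r.
    have [kj|] := eqVneq k j; last by rewrite mulr0 mul0r oppr0 eqxx.
    by rewrite Plow ?mulr0 ?oppr0 ?eqxx // vij -kj.
  have ltv : (v j < v' j)%N.
    rewrite ltn_neqAle lev andbT; apply/negP => /eqP/val_inj vj.
    have := v'0 j; rewrite -vj TPA eqxx mulr1 -{2}vij /c divfK ?subrr ?eqxx //.
  exists v'; first by exists (T *m P).
  rewrite /wt (bigD1 j) //= [X in (_ < X)%N](bigD1 j) //= -addSn leq_add // leq_sum //.
have [v0 gv0] : exists v, good v.
  have [v [v0 vlow]] := low _ Afree; exists v, 1%:M.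
  by rewrite mul1mx; split=> //; exact: unitmx1.
suff [v [P [Pu P0 Plow]] vi] : exists2 v, good v & injective v by exists P, v.
have bnd v : (wt v <= s * m)%N.
  apply: leq_trans (_ : \sum_(i < s) m <= _)%N.
    by apply: leq_sum => i _; exact: ltnW.
  by rewrite sum_nat_const card_ord.
have [k] := ubnP (s * m - wt v0); elim: k => // k IHk in v0 gv0 *.
move=> lek; have [vi|[v' gv' lt]] := step _ gv0; first by exists v0.
by apply: (IHk v') => //; have := bnd v'; lia.
Qed.

(* If the rows of [A] are the polynomials [f_i], the entries of
   [dilation_mx A] are [f_i(2 ^ l X)]. *)
Definition dilation_mx (F : numFieldType) (s m : nat) (A : 'M[F]_(s, m)) :
    'M[{poly F}]_s :=
  map_mx polyC A *m \matrix_(k, l) ((2 ^+ (l * k))%:P * 'X^k).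

(* A multiplicative Wronskian: after echelonizing [A], dividing row [i] by its
   lowest monomial [X ^ v i] and evaluating at [0] leaves a Vandermonde matrix. *)
Lemma det_dilation_mx_neq0 (F : numFieldType) (s m : nat) (A : 'M[F]_(s, m)) :
  row_free A -> \det (dilation_mx A) != 0.
Proof.
case/lowest_echelon=> P [v [Pu vinj P0 Plow]].
have dP : \det (dilation_mx (P *m A)) = (\det P)%:P * \det (dilation_mx A).
  by rewrite /dilation_mx map_mxM -mulmxA det_mulmx det_map_mx.
suff : \det (dilation_mx (P *m A)) != 0.
  by apply: contraNneq; rewrite dP => ->; rewrite mulr0.
move: (P *m A) P0 Plow => {Pu dP P}A A0 Alow.
pose N : 'M[{poly F}]_s :=
  \matrix_(i, l) \sum_(k < m | (v i <= k)%N) ((A i k * 2 ^+ (l * k))%:P * 'X^(k - v i)).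
have -> : dilation_mx A = diag_mx (\row_i 'X^(v i)) *m N.
  apply/matrixP => i l; rewrite mul_diag_mx !mxE mulr_sumr [RHS]big_mkcond.
  apply: eq_bigr => k _; rewrite !mxE; case: leqP => [vk | /Alow ->];
    last by rewrite mul0r.
  by rewrite [RHS]mulrCA -exprD subnKC // polyCM mulrA.
rewrite det_mulmx det_diag mulf_neq0 //.
  by apply/prodf_neq0 => i _; rewrite mxE expf_neq0 ?polyX_eq0.
suff : horner_eval 0 (\det N) != 0.
  by apply: contraNneq => ->; rewrite /horner_eval horner0.
pose a : 'rV[F]_s := \row_i 2 ^+ (v i).
rewrite -det_map_mx.
have -> : map_mx (horner_eval 0) N = diag_mx (\row_i A i (v i)) *m (Vandermonde s a)^T.
  apply/matrixP => i l; rewrite mul_diag_mx !mxE /horner_eval /= horner_sum.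
  rewrite (bigD1 (v i)) //= subnn big1 => [|k /andP[vk kv]].
    by rewrite hornerM !hornerC mulr1 addr0 -exprM mulnC.
  rewrite hornerM hornerXn expr0n subn_eq0.
  suff /negbTE-> : ~~ (k <= v i)%N by rewrite mulr0.
  by apply: contra kv => kv; rewrite -val_eqE eqn_leq kv vk.
rewrite det_mulmx det_diag det_tr det_Vandermonde mulf_neq0 //.
  by apply/prodf_neq0 => i _; rewrite mxE.
apply/prodf_neq0 => i _; apply/prodf_neq0 => j ij; rewrite !mxE subr_eq0.
have [//|ne] := boolP (v j == v i).
  by rewrite (inj_eq vinj) eq_sym -val_eqE (ltn_eqF ij).
by rewrite -!natrX eqr_nat eqn_exp2l.
Qed.

Lemma size_det_dilation_mx (F : numFieldType) (s m : nat) (A : 'M[F]_(s, m)) :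
  ((size (\det (dilation_mx A))).-1 <= s * m.-1)%N.
Proof.
have sz i j : (size (dilation_mx A i j) <= m)%N.
  rewrite mxE; apply: leq_trans (size_sum _ _ _) _; apply/bigmax_leqP => k _.
  rewrite !mxE mulrA -polyCM mul_polyC (leq_trans (size_scale_leq _ _)) //.
  by rewrite size_polyXn.
have szdet : (size (\det (dilation_mx A)) <= (s * m.-1).+1)%N.
  apply: leq_trans (size_sum _ _ _) _; apply/bigmax_leqP => g _.
  have szg : (size (\prod_i dilation_mx A i (g i))%R <= (s * m.-1).+1)%N.
    apply: leq_trans (size_prod_leq _ _) _; rewrite card_ord leq_subLR addnS ltnS.
    rewrite -mulnS mulnC -[X in (_ <= _ * X)%N]card_ord mulnC -sum_nat_const.
    by apply: leq_sum => i _; apply: leq_trans (sz i (g i)) (leqSpred m).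
  by rewrite -signr_odd mulr_sign; case: ifP => _; rewrite ?size_polyN.
by rewrite -subn1 leq_subLR add1n.
Qed.

(** Right multiplication by it evaluates a coefficient row at the [j]-th block of [n] consecutive
    powers of 2. *)
Definition geom_mx (F : numFieldType) (m n j : nat) : 'M[F]_(m, n) :=
  \matrix_(k, l) (2 ^+ (j * n + l)) ^+ k.

(** For [p <= n - s], the dilation matrix at [2 ^ (j * n + p)] consists of the columns [p], ...,
    [p + s - 1] of [A *m geom_mx F m n j], so its corank is at least [s] minus the rank of that
    product. These coranks are lower bounds for the multiplicities of distinct zeros of one
    determinant of degree at most [s * m.-1]. *)
Lemma subspace_design (F : numFieldType) (s m n J : nat) (A : 'M[F]_(s, m)) :
  row_free A -> (s <= n)%N ->
  ((\sum_(j < J) (s - \rank (A *m geom_mx F m n j))) * (n - s).+1 <= s * m.-1)%N.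
Proof.
move=> Afree sn; apply: leq_trans (size_det_dilation_mx A).
have d0 := det_dilation_mx_neq0 Afree; set q := \det _ in d0 *.
pose x (jp : 'I_J * 'I_(n - s).+1) : F := 2 ^+ (jp.1 * n + jp.2).
(* For [s = 0] the offset [p = n] would occur, and consecutive blocks of points would overlap. *)
have [s0|s_gt0] := posnP s; first by rewrite big1 // => j _; lia.
have n_gt0 : (0 < n)%N by lia.
have xinj : injective x.
  case=> j p [j' p'] /eqP; rewrite /x /= -!natrX eqr_nat eqn_exp2l // => /eqP e.
  have [pn pn'] : (p < n)%N /\ (p' < n)%N.
    by have := ltn_ord p; have := ltn_ord p'; lia.
  have /val_inj -> : j = j' :> nat.
    have /= := congr1 (divn^~ n) e; rewrite !divnMDl // !divn_small ?addn0 //.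
  congr (_, _); apply: val_inj.
  by have /= := congr1 (modn^~ n) e; rewrite !modnMDl !modn_small.
have us : uniq [seq x jp | jp <- enum {: 'I_J * 'I_(n - s).+1}]
  by rewrite map_inj_uniq ?enum_uniq.
apply: leq_trans (sum_mup_leq d0 us); rewrite big_map big_enum /=.
rewrite -(pair_bigA _ (fun j p => mup (x (j, p)) q)) /= big_distrl /=.
apply: leq_sum => j _; rewrite mulnC -[X in (X * _)%N]card_ord -sum_nat_const.
apply: leq_sum => p _; apply: leq_trans (corank_leq_mup_det _ d0).
rewrite leq_sub2l //.
have lt (l : 'I_s) : (p + l < n)%N.
  have := ltn_ord p; have := ltn_ord l; lia.
have -> : map_mx (horner^~ (x (j, p))) (dilation_mx A) =
    A *m geom_mx F m n j *m \matrix_(k, l) (k == Ordinal (lt l))%:R.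
  apply/matrixP => i l; rewrite [LHS]mxE [in LHS]mxE horner_sum.
  rewrite -mulmxA mxE; apply: eq_bigr => k _; rewrite !mxE.
  rewrite (bigD1 (Ordinal (lt l))) //= big1 => [|t /negbTE tl];
    last by rewrite !mxE tl mulr0.
  rewrite !mxE eqxx mulr1 addr0 !hornerE /x /= -mulrA -!exprM -exprD.
  by congr (_ * 2 ^+ _); lia.
exact: mxrankM_maxl.
Qed.

(** * A dimension expander from the subspace design *)

(** [U] ranges over all spaces containing [V] and its images, so that no span is formed; the factor
    11/10 is cleared of denominators. *)
Definition dim_expanding (F : fieldType) (I : Type) (n : nat) (A : I -> 'M[F]_n) :=
  forall V U : {vspace 'cV[F]_n}, (V <= U)%VS ->
    (forall i v, v \in V -> A i *m v \in U) ->
    (2 * \dim V <= n)%N -> (11 * \dim V <= 10 * \dim U)%N.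

Lemma vspace_row_free (F : fieldType) (n r : nat) (V : {vspace 'cV[F]_n}) :
  (r <= \dim V)%N ->
  exists Q : 'M[F]_(r, n), row_free Q /\ forall i, (row i Q)^T \in V.
Proof.
move=> rV; pose b i := (vbasis V)`_i.
pose Q : 'M[F]_(\dim V, n) := \matrix_i (b i)^T.
have Qfree : row_free Q.
  apply/inj_row_free => u uQ; have /freeP bfree := basis_free (vbasisP V).
  apply/rowP => i; rewrite mxE; apply: (bfree (u 0)); apply/colP => k.
  transitivity ((u *m Q) 0 k); last by rewrite uQ !mxE.
  by rewrite summxE [RHS]mxE; apply: eq_bigr => j _; rewrite !mxE.
exists (pid_mx r *m Q); split.
  by rewrite /row_free mxrankMfree // rank_pid_mx.
move=> i; rewrite row_mul mulmx_sum_row linear_sum memv_suml // => j _.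
by rewrite linearZ /= rowK trmxK memvZ // vbasis_mem // mem_nth // size_tuple.
Qed.

Lemma vspace_row_space (F : fieldType) (n : nat) (U : {vspace 'cV[F]_n}) :
  exists Q : 'M[F]_(\dim U, n), forall v, v \in U -> (v^T <= Q)%MS.
Proof.
exists (\matrix_j (tnth (vbasis U) j)^T) => v vU.
apply/submxP; exists (\row_j coord (vbasis U) j v).
apply/rowP => k; rewrite !mxE [in LHS](coord_vbasis vU) summxE.
by apply: eq_bigr => j _; rewrite !mxE (tnth_nth 0).
Qed.

(** For [p = (j, i)], the coefficients of [f] go to the values of [X ^ (n i) f] on block [j]; the
    transpose makes the matrix act on columns. *)
Definition design_mx (F : numFieldType) (n : nat) (p : 'I_100 * 'I_4) : 'M[F]_n :=
  (submxcol (geom_mx F (\sum_(i < 4) n) n p.1) p.2)^T.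

Lemma design_mx_expanding (F : numFieldType) (n : nat) : (30 <= n)%N ->
  dim_expanding (@design_mx F n).
Proof.
move=> n30 V U VU AVU Vn; set k := \dim V in Vn *.
(* The cap [n %/ 5] keeps [n - 4 * r] at least [n / 5], so each block still supplies many zeros. *)
pose r := minn k (n %/ 5).
have [Q [Qfree QV]] := vspace_row_free (geq_minl k (n %/ 5) : (r <= \dim V)%N).
have [QU QUP] := vspace_row_space U.
have [Q' QQ'] := row_freeP Qfree.
(* The rows are the coefficients of the [X ^ (n i) f], for [f] a row of [Q]. *)
pose A := \mxblock_(i < 4, j < 4) (Q *+ (i == j)).
have Afree : row_free A.
  apply/row_freeP; exists (\mxblock_(i < 4, j < 4) (Q' *+ (i == j))).
  rewrite mul_mxblock -(mxdiagZ (p_ := fun=> r)) /mxdiag; apply/eq_mxblock => i j.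
  rewrite (bigD1 i) //= eqxx mulr1n big1 ?addr0 => [|k' /negbTE ki].
    by case: (i == j); rewrite ?conform_mx_id ?mulr1n ?QQ' // mulr0n mulmx0.
  by rewrite eq_sym ki mulr0n mul0mx.
have rk (j : 'I_100) : (\rank (A *m geom_mx F (\sum_(i < 4) n) n j) <= \dim U)%N.
  rewrite -(submxcolK (geom_mx F _ n j)) mul_mxblock_mxrow eqmx_col.
  apply: leq_trans (rank_leq_row QU); apply: mxrankS; apply/sumsmx_subP => i _.
  rewrite genmxE summx_sub // => i' _.
  case: (i == i'); rewrite ?mulr0n ?mul0mx ?sub0mx // mulr1n.
  apply/row_subP => a; rewrite row_mul -[_ *m _]trmxK trmx_mul.
  exact: QUP (AVU (j, i') _ (QV a)).
have s_le : (\sum_(i < 4) r <= n)%N.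
  by rewrite sum_nat_const card_ord; have := leq_trunc_div n 5; lia.
have := subspace_design 100 Afree s_le.
have le_rk : (\sum_(j < 100) (\sum_(i < 4) r - \dim U) <= \sum_(j < 100)
    (\sum_(i < 4) r - \rank (A *m geom_mx F (\sum_(i < 4) n) n j)))%N.
  by apply: leq_sum => j _; rewrite leq_sub2l.
move/(leq_trans (leq_mul le_rk (leqnn _))).
rewrite !sum_nat_const !card_ord => le.
have r5 : (5 * r <= n)%N by have := leq_trunc_div n 5; lia.
(* Since [n <= 5 * (n - 4 * r).+1], a hundred blocks bring the deficit [4 * r - \dim U] down to a
   fifth of [4 * r]. *)
have le1 : (100 * (4 * r - \dim U) * n <= 5 * (4 * r * (4 * n)))%N by nia.
have le2 : (5 * (4 * r - \dim U) <= 4 * r)%N by nia.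
(* Now [\dim U >= 16 r / 5]. If [r = n %/ 5 < k], this exceeds [11 n / 20 >= 11 k / 10] because
   [n >= 30]. *)
have [kr|rk'] := leqP k (n %/ 5); first by rewrite /r (minn_idPl kr) in le2; lia.
have := ltn_pmod n (isT : (0 < 5)%N); have := divn_eq n 5.
rewrite /r (minn_idPr (ltnW rk')) in le2; lia.
Qed.

(** * Reduction to Hermitian matrices *)

Lemma trmxCM (C : numClosedFieldType) (m n p : nat) (A : 'M[C]_(m, n))
    (B : 'M[C]_(n, p)) : (A *m B)^t* = B^t* *m A^t*.
Proof. by rewrite trmx_mul map_mxM. Qed.

Definition hermitian_parts (C : numClosedFieldType) (I : Type) (n : nat)
    (A : I -> 'M[C]_n) (p : I * bool) : 'M[C]_n :=
  if p.2 then A p.1 + (A p.1)^t* else 'i *: (A p.1 - (A p.1)^t*).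

Lemma hermitian_partsP (C : numClosedFieldType) (I : Type) (n : nat)
    (A : I -> 'M[C]_n) p : (hermitian_parts A p)^t* = hermitian_parts A p.
Proof.
case: p => i [] /=; rewrite /hermitian_parts /=.
  by rewrite linearD /= map_mxD trmxCK addrC.
rewrite linearZ /= map_mxZ /= conjCi linearB /= map_mxB trmxCK.
by rewrite scaleNr -scalerN opprB.
Qed.

(** Each [A i] is a linear combination of its two Hermitian parts. *)
Lemma hermitian_parts_expanding (C : numClosedFieldType) (I : Type) (n : nat)
    (A : I -> 'M[C]_n) :
  dim_expanding A -> dim_expanding (hermitian_parts A).
Proof.
move=> Aexp V U VU HU; apply: Aexp => // i v vV.
have h1 := HU (i, true) v vV; have h2 := HU (i, false) v vV.
suff -> : A i *m v = 2^-1 *: (hermitian_parts A (i, true) *m v) -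
    ('i / 2) *: (hermitian_parts A (i, false) *m v).
  by rewrite memvB ?memvZ.
rewrite /hermitian_parts /= -scalemxAl scalerA mulrAC -expr2 sqrCi.
rewrite mulN1r scaleNr opprK -scalerDr -mulmxDl addrACA subrr addr0.
by rewrite -mulr2n -scaler_nat -scalemxAl scalerA mulVf ?scale1r ?pnatr_eq0.
Qed.

(** * Cayley transforms and their dimension expansion *)

Definition cayley (C : numClosedFieldType) (n : nat) (t : C) (H : 'M[C]_n) : 'M[C]_n :=
  (1%:M + ('i * t) *: H) *m invmx (1%:M - ('i * t) *: H).

Section Cayley.
Variables (C : numClosedFieldType) (n : nat) (t : C) (H : 'M[C]_n).
Hypotheses (t_real : t \is Num.real) (H_herm : H^t* = H).

Let S := 1%:M - ('i * t) *: H.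

Lemma trmxC_cayley_denom : S^t* = 1%:M + ('i * t) *: H.
Proof.
rewrite /S linearB /= map_mxB linearZ /= map_mxZ H_herm trmx1 map_mx1.
by rewrite /= rmorphM /= conjCi (CrealP t_real) mulNr scaleNr opprK.
Qed.

Lemma cayley_denom_add : S + S^t* = 2 *: 1%:M.
Proof. by rewrite trmxC_cayley_denom /S addrACA addNr addr0 -mulr2n scaler_nat. Qed.

(** As [S + S^t* = 2], a row [u] killed by [S] satisfies [2 u u^t* = 0]. *)
Lemma cayley_denom_unit : S \in unitmx.
Proof.
rewrite -row_free_unit; apply/inj_row_free => u uS.
have : u *m (S + S^t*) *m u^t* = 0.
  by rewrite mulmxDr uS add0r -mulmxA -trmxCM uS trmx0 map_mx0 mulmx0.
rewrite cayley_denom_add -scalemxAr mulmx1 -scalemxAl => /eqP.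
rewrite scaler_eq0 pnatr_eq0 => /eqP uu.
apply/eqP; apply: contraT => /dotmx_is_dotmx.
by rewrite dotmxE uu mxE ltxx.
Qed.

Lemma cayley_mul_denom : cayley t H *m S = S^t*.
Proof. by rewrite trmxC_cayley_denom mulmxKV ?cayley_denom_unit. Qed.

(** [S^t* = 2 - S] commutes with [S], so [S U = U S = S^t*] and [S U U^t* = S^t* U^t* = S]; then [S]
    cancels. *)
Lemma cayley_unitary : cayley t H \is unitarymx.
Proof.
have Su := cayley_denom_unit.
have comm : S *m S^t* = S^t* *m S.
  rewrite (_ : S^t* = 2 *: 1%:M - S); last first.
    by apply/esym/eqP; rewrite subr_eq addrC cayley_denom_add.
  move: (S) => T.
  by rewrite mulmxBr mulmxBl -scalemxAl -scalemxAr mulmx1 mul1mx.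
have SU : S *m cayley t H = S^t*.
  by apply: (can_inj (mulmxK Su)); rewrite -mulmxA cayley_mul_denom.
apply/unitarymxP/(can_inj (mulKmx Su)).
by rewrite mulmxA SU mulmx1 -trmxCM cayley_mul_denom trmxCK.
Qed.

Lemma invmx_cayley_denom : invmx S = 2^-1 *: (1%:M + cayley t H).
Proof.
apply: (can_inj (mulmxK cayley_denom_unit)); rewrite mulVmx ?cayley_denom_unit //.
rewrite -scalemxAl mulmxDl mul1mx cayley_mul_denom cayley_denom_add.
by rewrite scalerA mulVf ?scale1r ?pnatr_eq0.
Qed.

(** Isolates the factor [t] without an inverse; unitarity bounds the remaining [1 + U]. *)
Lemma cayley_sub1 : cayley t H - 1%:M = ('i * t) *: ((1%:M + cayley t H) *m H).
Proof.
have := cayley_mul_denom; rewrite trmxC_cayley_denom mulmxBr mulmx1 -scalemxAr.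
move/eqP; rewrite subr_eq => /eqP e; rewrite {1}e.
by rewrite mulmxDl mul1mx scalerDr [LHS]addrC !addrA addNr add0r.
Qed.
End Cayley.

(** Each [Wi i] has codimension at most [c] in [W], so each intersection costs at most [c]
    dimensions. *)
Lemma dim_bigcap_ge (F : fieldType) (vT : vectType F) (I : Type) (r : seq I)
    (X W : {vspace vT}) (Wi : I -> {vspace vT}) (c : nat) :
  (X <= W)%VS -> (forall i, (Wi i <= W)%VS) ->
  (forall i, \dim W <= \dim (Wi i) + c)%N ->
  (\dim X <= \dim (X :&: \bigcap_(i <- r) Wi i) + size r * c)%N.
Proof.
move=> XW WiW dW; elim: r X XW => [|i r IHr] X XW.
  by rewrite big_nil capvf addn0.
rewrite big_cons capvA /= mulSn.
have {}IHr := IHr (X :&: Wi i)%VS (subv_trans (capvSl _ _) XW).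
have := dimv_sum_cap X (Wi i).
have /dimvS : (X + Wi i <= W)%VS by rewrite subv_add XW WiW.
have := dW i; lia.
Qed.

(* With [S = 1 - itH], the Cayley transform is [2 S^-1 - 1], so [V + UV]
   contains the space [S^-1 V], which has the dimension of [V]; and [H] maps
   [V :&: S^-1 V] into [V + S^-1 V] because [S w] lies in [V]. *)
Lemma cayley_expansion (C : numClosedFieldType) (I : finType) (n : nat) (t : C)
    (H : I -> 'M[C]_n) (V W : {vspace 'cV[C]_n}) :
  t \is Num.real -> t != 0 -> (forall i, (H i)^t* = H i) -> dim_expanding H ->
  (V <= W)%VS -> (forall i v, v \in V -> cayley t (H i) *m v \in W) ->
  (2 * \dim V <= n)%N ->
  ((11 + 11 * #|I|) * \dim V <= (10 + 11 * #|I|) * \dim W)%N.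
Proof.
move=> treal t0 Hherm Hexp VW UW Vn.
pose S i := 1%:M - ('i * t) *: H i.
have Su i : S i \in unitmx by exact: cayley_denom_unit.
pose Wi i := (linfun (mulmx (invmx (S i))) @: V)%VS.
have WiW i : (Wi i <= W)%VS.
  apply/subvP => _ /memv_imgP[v vV ->]; rewrite lfunE /= invmx_cayley_denom //.
  rewrite -scalemxAl mulmxDl mul1mx memvZ // memvD ?UW //.
  exact: subvP vV.
have dimWi i : \dim (Wi i) = \dim V.
  apply: limg_dim_eq; apply/eqP; rewrite -subv0; apply/subvP => v.
  rewrite memv_cap memv_ker lfunE /= => /andP[_ /eqP Sv0].
  by rewrite memv0 -[v](mulKVmx (Su i)) Sv0 mulmx0.
pose X := (V :&: \bigcap_(i <- enum I) Wi i)%VS.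
have dimX : (\dim V <= \dim X + #|I| * (\dim W - \dim V))%N.
  rewrite cardE; apply: (dim_bigcap_ge _ VW WiW) => i; rewrite dimWi.
  by have := dimvS VW; lia.
have XV : (X <= V)%VS by exact: capvSl.
have HX i v : v \in X -> H i *m v \in W.
  rewrite memv_cap => /andP[vV]; rewrite big_enum => vWi.
  have /memv_imgP[w wV vE] : v \in Wi i by apply: subvP vWi; exact: bigcapv_inf.
  have Sv : S i *m v = w by rewrite vE lfunE /= mulKVmx.
  have -> : H i *m v = ('i * t)^-1 *: (v - w).
    rewrite -Sv /S mulmxBl mul1mx opprB addrCA subrr addr0 -scalemxAl scalerA.
    by rewrite mulVf ?scale1r // mulf_neq0 ?neq0Ci.
  by rewrite memvZ // memvB // (subvP VW).
have Xn : (2 * \dim X <= n)%N by apply: leq_trans Vn; rewrite leq_mul2l dimvS.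
(* [11 k <= 11 x + 11 d (w - k) <= 10 w + 11 d (w - k)]. *)
have arith (d k w x : nat) : (k <= w -> k <= x + d * (w - k) -> 11 * x <= 10 * w ->
    (11 + 11 * d) * k <= (10 + 11 * d) * w)%N.
  by move=> kw; have := leq_mul (leqnn d) kw; rewrite mulnBr; nia.
exact: arith (dimvS VW) dimX (Hexp X W (subv_trans XV VW) HX Xn).
Qed.

(** * Norm estimates for the Laplacian *)

(** A submultiplicative norm dominating every entry; its losses in [n] are harmless because [t] is
    chosen after [n]. *)
Definition l1norm (C : numClosedFieldType) (m n : nat) (A : 'M[C]_(m, n)) : C :=
  \sum_i \sum_j `|A i j|.

Section L1norm.
Variable C : numClosedFieldType.

Lemma l1norm_ge0 m n (A : 'M[C]_(m, n)) : 0 <= l1norm A.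
Proof. by apply: sumr_ge0 => i _; apply: sumr_ge0. Qed.

Lemma normr_entry_le_l1norm m n (A : 'M[C]_(m, n)) i j : `|A i j| <= l1norm A.
Proof.
rewrite /l1norm (bigD1 i) //= (bigD1 j) //= -addrA lerDl addr_ge0 //.
  exact: sumr_ge0.
by apply: sumr_ge0 => k _; exact: sumr_ge0.
Qed.

Lemma l1normD m n (A B : 'M[C]_(m, n)) : l1norm (A + B) <= l1norm A + l1norm B.
Proof.
rewrite /l1norm -big_split; apply: ler_sum => i _; rewrite -big_split.
by apply: ler_sum => j _; rewrite mxE ler_normD.
Qed.

Lemma l1normZ m n a (A : 'M[C]_(m, n)) : l1norm (a *: A) = `|a| * l1norm A.
Proof.
rewrite /l1norm mulr_sumr; apply: eq_bigr => i _; rewrite mulr_sumr.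
by apply: eq_bigr => j _; rewrite mxE normrM.
Qed.

Lemma l1normN m n (A : 'M[C]_(m, n)) : l1norm (- A) = l1norm A.
Proof. by rewrite -scaleN1r l1normZ normrN1 mul1r. Qed.

Lemma l1norm_sum m n (I : finType) (A : I -> 'M[C]_(m, n)) :
  l1norm (\sum_i A i) <= \sum_i l1norm (A i).
Proof.
elim/big_rec2: _ => [|i y x _ le]; last by rewrite (le_trans (l1normD _ _)) // lerD2l.
by rewrite /l1norm big1 // => i _; rewrite big1 // => j _; rewrite mxE normr0.
Qed.

Lemma l1normM m n p (A : 'M[C]_(m, n)) (B : 'M[C]_(n, p)) :
  l1norm (A *m B) <= l1norm A * l1norm B.
Proof.
rewrite {1 2}/l1norm mulr_suml; apply: ler_sum => i _; rewrite mulr_suml.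
apply: le_trans (_ : \sum_j \sum_k `|A i k| * `|B k j| <= _).
  by apply: ler_sum => j _; rewrite mxE (le_trans (ler_norm_sum _ _ _)) //
    ler_sum // => k _; rewrite normrM.
rewrite exchange_big; apply: ler_sum => k _; rewrite -mulr_sumr ler_wpM2l //.
by rewrite /l1norm (bigD1 k) //= lerDl sumr_ge0 // => l _; exact: sumr_ge0.
Qed.

Lemma l1norm_delta m n i j : l1norm (delta_mx i j : 'M[C]_(m, n)) = 1.
Proof.
rewrite /l1norm (bigD1 i) //= (bigD1 j) //= !big1 ?addr0 ?mxE ?eqxx ?normr1 //.
  by move=> k /negbTE ki; rewrite big1 // => l _; rewrite mxE ki normr0.
by move=> l /negbTE lj; rewrite mxE lj andbF normr0.
Qed.

Lemma l1norm_trmxC m n (A : 'M[C]_(m, n)) : l1norm (A^t*) = l1norm A.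
Proof.
rewrite /l1norm exchange_big; apply: eq_bigr => i _; apply: eq_bigr => j _.
by rewrite !mxE norm_conjC.
Qed.

Lemma l1norm1 n : l1norm (1%:M : 'M[C]_n) = n%:R.
Proof.
rewrite /l1norm -[in RHS](card_ord n) -sum1_card natr_sum; apply: eq_bigr => i _.
rewrite (bigD1 i) //= big1 ?addr0 ?mxE ?eqxx ?normr1 // => j /negbTE ji.
by rewrite mxE eq_sym ji normr0.
Qed.

Lemma l1norm_unitary n (U : 'M[C]_n) : U \is unitarymx -> l1norm U <= (n * n)%:R.
Proof.
move=> /unitarymxP UU.
have le1 i j : `|U i j| <= 1.
  rewrite -(@expr_le1 _ 2) // -[leRHS](_ : (1%:M : 'M[C]_n) i i = 1);
    last by rewrite mxE eqxx.
  rewrite -UU mxE (bigD1 j) //= !mxE -normCK lerDl sumr_ge0 // => k _.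
  by rewrite !mxE -normCK exprn_ge0.
apply: le_trans (_ : \sum_(i < n) \sum_(j < n) 1 <= _).
  by do 2! [apply: ler_sum => ? _].
by rewrite sumr_const card_ord sumr_const card_ord -mulrnA lexx.
Qed.

(* [U - 1 = it (1 + U) H], and [X - U X U^* = (X (U - 1) - (U - 1) X) U^*]. *)
Lemma l1norm_cayley_conj n (t : C) (H X : 'M[C]_n) :
  t \is Num.real -> H^t* = H ->
  l1norm (X - cayley t H *m X *m (cayley t H)^t*) <=
    `|t| * (2 * (n + n * n)%:R * l1norm H * (n * n)%:R) * l1norm X.
Proof.
move=> treal Hherm; have Uu := cayley_unitary treal Hherm.
have E1 := cayley_sub1 treal Hherm; set U := cayley t H in Uu E1 *.
have lU := l1norm_unitary Uu.
pose E := U - 1%:M.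
have -> : X - U *m X *m U^t* = (X *m E - E *m X) *m U^t*.
  rewrite /E [X *m (U - _)]mulmxBr [(U - _) *m X]mulmxBl mulmx1 mul1mx.
  rewrite opprB addrA subrK mulmxBl.
  by rewrite -[X *m U *m _]mulmxA (unitarymxP Uu) mulmx1.
have lE : l1norm E <= `|t| * ((n + n * n)%:R * l1norm H).
  rewrite /E E1 l1normZ normrM normCi mul1r ler_wpM2l //.
  rewrite (le_trans (l1normM _ _)) // ler_wpM2r ?l1norm_ge0 //.
  by rewrite (le_trans (l1normD _ _)) // l1norm1 natrD lerD2l.
apply: le_trans (l1normM _ _) _; rewrite l1norm_trmxC.
have lXE : l1norm (X *m E - E *m X) <= 2 * (l1norm E * l1norm X).
  rewrite (le_trans (l1normD _ _)) // l1normN mulr_natl mulr2n lerD //.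
    by rewrite mulrC l1normM.
  exact: l1normM.
apply: le_trans (ler_pM (l1norm_ge0 _) (l1norm_ge0 _) lXE lU) _.
rewrite [leRHS](_ : _ =
  2 * ((`|t| * ((n + n * n)%:R * l1norm H)) * l1norm X) * (n * n)%:R); last by ring.
by rewrite ler_wpM2r ?ler0n // ler_wpM2l ?ler0n // ler_wpM2r ?l1norm_ge0.
Qed.
End L1norm.

(** The Laplacian is the average over [i] of the maps sending [X] to [X - B i *m X *m (B i)^t*]. *)
Lemma l1norm_quantum_laplacian (R : realType) (n d : nat)
    (B : 'I_d -> 'M[R[i]]_n) (c : R[i]) (X : 'M[R[i]]_n) : (0 < d)%N ->
  (forall i, l1norm (X - B i *m X *m (B i)^t*) <= c) ->
  l1norm (quantum_laplacian B X) <= c.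
Proof.
move=> d0 Bc; have dn0 : d%:R != 0 :> R[i] by rewrite pnatr_eq0 -lt0n.
have -> : quantum_laplacian B X = d%:R^-1 *: \sum_i (X - B i *m X *m (B i)^t*).
  rewrite /quantum_laplacian /quantum_channel sumrB scalerBr sumr_const card_ord.
  by rewrite -(scaler_nat d X) scalerA mulVf // scale1r.
rewrite l1normZ ger0_norm ?invr_ge0 ?ler0n // ler_pdivrMl ?ltr0n //.
apply: le_trans (l1norm_sum _) _; apply: le_trans (ler_sum _ (fun i _ => Bc i)) _.
by rewrite sumr_const card_ord mulr_natl.
Qed.

(** The squares of the singular values are nonnegative and sum to the trace of [A *m A^t*], which is
    the sum of the squared moduli of the entries. *)
Lemma singular_values_le (R : realType) (m : nat) (A : 'M[R[i]]_m) (b s : R) :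
  (forall i j, `|A i j| <= b%:C) -> s \in singular_values A -> s <= m%:R * b.
Proof.
move=> Ab; rewrite mem_sort => /mapP[j _ ->].
have m0 : (0 < m)%N by apply: leq_ltn_trans (ltn_ord j).
have b0 : 0 <= b by rewrite -lecR (le_trans (normr_ge0 _) (Ab j j)).
set D := spectral_diag _; have D0 k : 0 <= D 0 k := gram_spectral_diag_ge0 A k.
have trD : \tr (A *m A^t*) = \sum_k D 0 k.
  have /orthomx_spectralP {1}-> : A *m A^t* \is normalmx.
    by apply/normalmxP; rewrite trmxCM trmxCK.
  by rewrite -mulmxA mxtrace_mulC mulmxK ?spectral_unit // mxtrace_diag.
have Dle : D 0 j <= ((m%:R * b) ^+ 2)%:C.
  apply: (@le_trans _ _ (\tr (A *m A^t*))).
    by rewrite trD (bigD1 j) //= lerDl sumr_ge0.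
  apply: le_trans (_ : \sum_(i < m) \sum_(k < m) (b ^+ 2)%:C <= _).
    apply: ler_sum => i _; rewrite mxE; apply: ler_sum => k _.
    by rewrite !mxE -normCK rmorphXn lerXn2r ?nnegrE ?normr_ge0 ?Ab ?ler0c.
  rewrite sumr_const card_ord sumr_const card_ord -rmorphMn -rmorphMn lecR.
  by rewrite exprMn -mulrnA -[leLHS]mulr_natl natrM -(expr2 m%:R).
rewrite -[leRHS]ger0_norm ?mulr_ge0 // -sqrtr_sqr ler_wsqrtr //.
by move: Dle (D0 j); case: (D 0 j) => x y; rewrite !lecE /= => /andP[_].
Qed.

(** The rows of [lin_mx] are the images of the [delta_mx i j], so [b] bounds every entry of this
    matrix of size [n * n]. *)
Lemma quantum_expansion_le (R : realType) (n d : nat)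
    (B : 'I_d -> 'M[R[i]]_n) (b : R) : 0 <= b ->
  (forall i j, l1norm (quantum_laplacian B (delta_mx i j)) <= b%:C) ->
  quantum_expansion B <= (n * n)%:R * b.
Proof.
move=> b0 Bb; rewrite /quantum_expansion /operator_singular_values.
set s := singular_values _.
(* Without a second singular value, [nth] returns its default 0. *)
have [lt|le] := ltnP 1 (size s); last by rewrite nth_default // mulr_ge0.
apply: singular_values_le (mem_nth _ lt) => x y.
case/mxvec_indexP: x => i k; rewrite mxE /= vec_mx_delta.
case/mxvec_indexP: y => i' k'; rewrite mxvecE.
exact: le_trans (normr_entry_le_l1norm _ _ _) (Bb i k).
Qed.

Lemma dim_expansion_ge (R : realType) (n d : nat) (B : 'I_d -> 'M[R[i]]_n) (mu : R) :
  (2 <= n)%N ->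
  (forall V W : {vspace 'cV[R[i]]_n}, (V <= W)%VS ->
     (forall i v, v \in V -> B i *m v \in W) -> (2 * \dim V <= n)%N ->
     (1 + mu) * (\dim V)%:R <= (\dim W)%:R) ->
  mu <= dim_expansion B.
Proof.
move=> n2 Bmu; have [[V [V1 Vn] <-] _] := dim_expansion_attained B n2.
rewrite /expansion_ratio ler_pdivlMr ?ltr0n // lerBrDr -[X in _ + X]mul1r -mulrDl.
rewrite addrC; apply: Bmu; first exact: addvSl.
  move=> i v vV; have /tuple_image_subP sub := subvv (tuple_image B V).
  by apply: (subvP (addvSr _ _)); exact: sub.
by rewrite -(ler_nat R) natrM mulrC -ler_pdivlMr ?ltr0n.
Qed.

(** * Choice of the constants and of [t] *)

Theorem theorem1p8 (R : realType) :
  exists (mu : R) (d : nat), 0 < mu /\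
    forall eps : R, 0 < eps ->
      exists N : nat, forall n : nat, (N <= n)%N ->
        exists B : 'I_d -> 'M[R[i]]_n,
          (forall i : 'I_d, B i \is unitarymx) /\
          mu <= dim_expansion B /\
          quantum_expansion B < eps.
Proof.
(* 100 blocks of points, 4 shifts and 2 Hermitian parts: 800 matrices. *)
pose I : finType := ('I_100 * 'I_4 * bool)%type.
exists (10 + 11 * #|I|)%:R^-1, #|I|; split; first by rewrite invr_gt0 ltr0n addn_gt0.
(* The threshold is uniform in [eps], which enters only through [t]. *)
move=> eps eps0; exists 30 => n n30.
pose H := hermitian_parts (@design_mx R[i] n).
have Hexp : dim_expanding H.
  exact/hermitian_parts_expanding/design_mx_expanding.
have Hherm p : (H p)^t* = H p := hermitian_partsP _ p.
pose K (p : I) : R[i] := 2 * (n + n * n)%:R * l1norm (H p) * (n * n)%:R.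
have K0 p : 0 <= K p by rewrite !mulr_ge0 ?ler0n ?l1norm_ge0.
have [k k0 kE] : exists2 k : R, 0 <= k & \sum_p K p = k%:C.
  have sK0 : 0 <= \sum_p K p by apply: sumr_ge0.
  exists (complex.Re (\sum_p K p)).
    by move: sK0; rewrite lecE /= => /andP[].
  by rewrite RRe_real // ger0_real.
(* Chosen so that [n ^ 2 * t * k < eps]; the [+ 1] covers [k = 0]. *)
pose t : R := eps / ((n * n)%:R * k + 1).
have den0 : 0 < (n * n)%:R * k + 1 by rewrite ltr_wpDl ?mulr_ge0.
have t0 : 0 < t by rewrite divr_gt0.
have treal : t%:C \is Num.real by rewrite complex_real.
exists (fun i => cayley t%:C (H (enum_val i))); split; [|split].
- by move=> i; exact: cayley_unitary.
- apply: dim_expansion_ge => [|V W VW BW Vn]; first exact: leq_trans n30.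
  have den : (0 : R) < (10 + 11 * #|I|)%:R by rewrite ltr0n addn_gt0.
  have tC0 : t%:C != 0 by rewrite gt_eqF // ltcR.
  have HW p v : v \in V -> cayley t%:C (H p) *m v \in W.
    by move=> vV; have := BW (enum_rank p) v vV; rewrite enum_rankK.
  have := cayley_expansion treal tC0 Hherm Hexp VW HW Vn.
  rewrite -[(11 + _)%N]/((10 + 11 * #|I|).+1) -(ler_nat R) !natrM mulrS.
  by rewrite -ler_pdivrMl // mulrA mulrDr mulVf ?mulr1 1?gt_eqF // [_ + 1]addrC.
apply: le_lt_trans (_ : (n * n)%:R * (t * k) < _).
  apply: quantum_expansion_le => [|a b]; first by rewrite mulr_ge0 // ltW.
  apply: l1norm_quantum_laplacian => [|i].
    by rewrite card_prod card_bool !card_prod !card_ord.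
  apply: le_trans (l1norm_cayley_conj _ treal (Hherm _)) _.
  have -> : (t * k)%:C = t%:C * \sum_p K p by rewrite kE rmorphM.
  rewrite l1norm_delta mulr1 ger0_norm ?ler0c ?(ltW t0) //.
  rewrite ler_wpM2l ?ler0c ?(ltW t0) // (bigD1 (enum_val i)) //= lerDl.
  by apply: sumr_ge0.
by rewrite mulrCA /t mulrAC ltr_pdivrMr // ltr_pM2l // ltrDl ltr01.
Qed.
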